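(* Let $\vartheta>0$, $\alpha>0$ and $\lambda\in\mathbb{C}$. The sequence of functions $(\theta_{\lambda,n})_{n\geq 1}$ defined over $\mathscr{K}_s([0,\vartheta])$ (that is, a sequence of elements of $\mathscr{K}_s([0,\vartheta])$) by $$\theta_{\lambda,n}(t)=\frac{1}{(1-e^{-\alpha\vartheta})^n}\sum_{k=0}^{n}\mathrm{C}^k_n\,\Phi_\lambda\!\left(\frac{k}{n}\right)\left(e^{-\alpha t}-e^{-\alpha\vartheta}\right)^k\left(1-e^{-\alpha t}\right)^{n-k}$$ for $t\in[0,\vartheta]$ (and $0$ elsewhere), where $$\Phi_\lambda(\mu)=\theta_\lambda\!\left(-\alpha^{-1}\ln\big((1-e^{-\alpha\vartheta})\mu+e^{-\alpha\vartheta}\big)\right),\qquad \mu\in[0,1],$$ uniformly converges to $\theta_\lambda$.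
   Context: $\theta_\lambda(t)=e^{\lambda t}$ for $t\in[0,\vartheta]$ and $\theta_\lambda(t)=0$ elsewhere. $\mathrm{C}^k_n=\frac{n!}{k!(n-k)!}$. $\mathscr{K}_s([0,\vartheta])$ is the set of functions that vanish outside $[0,\vartheta]$ and equal on $[0,\vartheta]$ a finite sum $\sum_{i,j\geq 0}c_{ij}t^je^{\lambda_i t}$ with $c_{ij},\lambda_i\in\mathbb{C}$ and $\mathrm{Re}\,\lambda_i<0$ for all $i$. For $f\in\mathscr{L}_1(\mathbb{R}_+)$, $\|f\|_{\mathscr{A}}=\|f\|_{\mathscr{L}_1}=\int_0^\infty|f(t)|\,dt$. A sequence $f_n$ is said to uniformly converge to $f$ if for every $\varepsilon>0$ there is $n\in\mathbb{N}$ such that $\|f-f_\kappa\|_{\mathscr{A}}\le\varepsilon$ for all $\kappa\ge n$.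
   Formalization: Membership of θ_{λ,n} in K_s([0,ϑ]) fails in general (for λ=0, θ_{0,n}=1 on [0,ϑ], which is not in K_s); it is replaced by: θ_{λ,n} minus a constant multiple of the indicator function of [0,ϑ] lies in K_s([0,ϑ]). *)

(* Defs.v *)
From HB Require Import structures.
From mathcomp Require Import all_boot all_order all_algebra.
From mathcomp Require Import all_classical all_reals all_analysis.
From mathcomp.real_closed Require Import complex.

Set Implicit Arguments.
Unset Strict Implicit.
Unset Printing Implicit Defensive.

Import Order.TTheory GRing.Theory Num.Theory.

Local Open Scope classical_set_scope.
Local Open Scope ring_scope.
Local Open Scope complex_scope.

Definition cexp (R : realType) (z : R[i]) : R[i] :=
  (expR (complex.Re z))%:C * (cos (complex.Im z) +i* sin (complex.Im z)).

Definition L1 (R : realType) (f : R -> R[i]) : Prop :=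
  lebesgue_measure.-integrable `[0, +oo[ (fun t => (complex.Re (f t))%:E) /\
  lebesgue_measure.-integrable `[0, +oo[ (fun t => (complex.Im (f t))%:E).

Definition normA (R : realType) (f : R -> R[i]) : \bar R :=
  (\int[lebesgue_measure]_(t in `[0%R, +oo[) (Normc.normc (f t))%:E)%E.

(* The sequence is indexed by the positive integers: [u 0] is irrelevant. *)
Definition uniformly_converges (R : realType)
    (u : nat -> R -> R[i]) (f : R -> R[i]) : Prop :=
  [/\ L1 f,
      forall n, (0 < n)%N -> L1 (u n) &
      forall eps : R, 0 < eps ->
        exists2 n : nat, (0 < n)%N &
          forall k : nat, (n <= k)%N ->
            (normA (fun t => f t - u k t)%R <= eps%:E)%E].

Definition Ks (R : realType) (vartheta : R) (f : R -> R[i]) : Prop :=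
  (forall t, ~~ (0 <= t <= vartheta) -> f t = 0) /\
  exists (m p : nat) (c : 'I_m -> 'I_p -> R[i]) (l : 'I_m -> R[i]),
    (forall i, complex.Re (l i) < 0) /\
    forall t, 0 <= t <= vartheta ->
      f t = \sum_(i < m) \sum_(j < p) c i j * t%:C ^+ j * cexp (l i * t%:C).

(* [theta vartheta 0] is the indicator function of [0, vartheta]. It is not in
   [Ks vartheta]: on a nontrivial interval a nonzero constant is not a sum of
   terms t^j e^(l t) with Re l < 0. The approximants below are polynomials in
   e^(- alpha t) with a constant term in general (each is theta vartheta 0
   when lambda = 0), so they lie in Ks up to a multiple of this function. *)
Definition theta (R : realType) (vartheta : R) (lambda : R[i]) (t : R) : R[i] :=
  if 0 <= t <= vartheta then cexp (lambda * t%:C) else 0.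

Definition Phi (R : realType) (vartheta alpha : R) (lambda : R[i]) (mu : R) :
    R[i] :=
  theta vartheta lambda
    (- alpha^-1 * ln ((1 - expR (- alpha * vartheta)) * mu
                      + expR (- alpha * vartheta))).

Definition theta_seq (R : realType) (vartheta alpha : R) (lambda : R[i])
    (n : nat) (t : R) : R[i] :=
  if 0 <= t <= vartheta then
    (((1 - expR (- alpha * vartheta)) ^+ n)^-1)%:C *
    \sum_(0 <= k < n.+1)
      'C(n, k)%:R * Phi vartheta alpha lambda (k%:R / n%:R) *
      ((expR (- alpha * t) - expR (- alpha * vartheta)) ^+ k)%:C *
      ((1 - expR (- alpha * t)) ^+ (n - k))%:C
  else 0.

(* Main.v *)
(** Under the change of variable x = (e^(- alpha t) - b) / (1 - b), with
    b = e^(- alpha vartheta), the interval [0, vartheta] becomes [0, 1], the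
    function theta_lambda becomes Phi_lambda and theta_(lambda, n) becomes the
    n-th Bernstein polynomial of Phi_lambda. As Phi_lambda is Lipschitz (the
    logarithm is evaluated on [b, 1], away from 0), the variance n x (1 - x) of
    the binomial distribution makes these polynomials converge uniformly on
    [0, 1], hence in L^1 since everything vanishes outside [0, vartheta]. *)

Require Import Defs.
From mathcomp Require Import all_boot all_order all_algebra.
From mathcomp Require Import all_classical all_reals all_analysis.
From mathcomp.real_closed Require Import complex.
From mathcomp Require Import ring lra.

Import Order.TTheory GRing.Theory Num.Theory.
Import numFieldNormedType.Exports.

Local Open Scope ring_scope.
Local Open Scope complex_scope.

(** * Bernstein basis polynomials and the variance of the binomial distribution *)

Definition bernstein {R : comNzRingType} (n k : nat) (x : R) : R :=
  'C(n, k)%:R * x ^+ k * (1 - x) ^+ (n - k).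

(** Pascal's rule: the expectation of [f] over [n.+1] Bernoulli trials, conditioned on the last
    trial. This drives the induction on [n] for the variance. *)
Lemma sum_bernsteinS (R : comNzRingType) (n : nat) (x : R) (f : nat -> R) :
  \sum_(k < n.+2) bernstein n.+1 k x * f k =
  \sum_(k < n.+1) bernstein n k x * ((1 - x) * f k + x * f k.+1).
Proof.
under [RHS]eq_bigr do rewrite mulrDr.
rewrite big_split /= big_ord_recl [in RHS]big_ord_recl /=.
under eq_bigr => i _.
  rewrite /bump /= add1n /bernstein binS natrD subSS !mulrDl.
  over.
rewrite big_split /= addrA; congr (_ + _); last first.
  apply: eq_bigr => i _; rewrite /bernstein exprS.
  by move: ('C(_, _)%:R) (x ^+ _) ((1 - x) ^+ _) (f _) => a b c d; ring.
rewrite big_ord_recr /= bin_small // !mul0r addr0; congr (_ + _).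
  by rewrite /bernstein !bin0 !subn0 (exprS (1 - x));
    move: ((1 - x) ^+ n) => a; ring.
apply: eq_bigr => i _; rewrite /bump /= add1n /bernstein exprS.
rewrite -(subnSK (ltn_ord i)) (exprS (1 - x)).
by move: ('C(_, _)%:R) (x ^+ _) ((1 - x) ^+ _) (f _) => a b c d; ring.
Qed.

Lemma sum_bernstein (R : comNzRingType) (n : nat) (x : R) :
  \sum_(k < n.+1) bernstein n k x = 1.
Proof.
rewrite -(expr1n R n) -[in RHS](subrK x 1) exprDn; apply: eq_bigr => k _.
by rewrite /bernstein -mulr_natl; ring.
Qed.

(** One more trial turns the deviation d = k - n x into d - x with weight 1 - x, or into d + 1 - x
    with weight x. The weighted squares add up to d^2 + x (1 - x), so each trial contributes x (1 -
    x). *)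
Lemma bernstein_variance (R : comNzRingType) (n : nat) (x : R) :
  \sum_(k < n.+1) bernstein n k x * (k%:R - n%:R * x) ^+ 2 =
  n%:R * (x * (1 - x)).
Proof.
elim: n => [|n IHn].
  by rewrite big_ord_recl big_ord0 /bernstein /=; ring.
rewrite (sum_bernsteinS _ _ _ (fun k => (k%:R - n.+1%:R * x) ^+ 2)).
have -> : n.+1%:R * (x * (1 - x)) = n%:R * (x * (1 - x)) +
    \sum_(k < n.+1) bernstein n k x * (x * (1 - x)).
  by rewrite -mulr_suml sum_bernstein mulrSr; ring.
rewrite -IHn -big_split /=; apply: eq_bigr => k _.
by rewrite !mulrSr; ring.
Qed.

Lemma bernstein_ge0 (R : realDomainType) (n k : nat) (x : R) :
  0 <= x <= 1 -> 0 <= bernstein n k x.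
Proof.
by case/andP=> x0 x1; rewrite /bernstein !mulr_ge0 ?exprn_ge0 ?subr_ge0.
Qed.

(** * Complex modulus and Bernstein approximation of a Lipschitz function *)

Lemma normc_real (R : realType) (x : R) : Normc.normc x%:C = `|x|.
Proof. by rewrite /Normc.normc /= expr0n addr0 sqrtr_sqr. Qed.

(** [Rcomplex R] is [R[i]] normed over the reals by [Normc.normc], so the generic triangle
    inequality applies. *)
Lemma normc_sum (R : realType) (I : Type) (r : seq I) (P : pred I)
    (F : I -> R[i]) :
  Normc.normc (\sum_(i <- r | P i) F i) <=
  \sum_(i <- r | P i) Normc.normc (F i).
Proof. exact: (@ler_norm_sum _ (Rcomplex R)). Qed.

Lemma normc_le_ReIm (R : realType) (z : R[i]) :
  Normc.normc z <= `|complex.Re z| + `|complex.Im z|.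
Proof.
case: z => a b /=; rewrite -(ger0_norm (addr_ge0 (normr_ge0 a) (normr_ge0 b))).
rewrite -sqrtr_sqr ler_sqrt ?sqr_ge0 // sqrrD !real_normK ?num_real //.
by rewrite -addrA lerD2l lerDr mulrn_wge0 // mulr_ge0.
Qed.

(** A Chebyshev-type estimate: the weights sum to 1, so the error is an average of differences of
    [g]. The mean of |x - k/n| is at most [eta] plus the variance of k/n divided by [eta], and x (1
    - x) <= 1. The parameter [eta] is left free, to be balanced against [n] later. *)
Lemma bernstein_approx (R : realType) (g : R -> R[i]) (L eta x : R) (n : nat) :
  (0 < n)%N -> 0 < eta -> 0 <= L -> 0 <= x <= 1 ->
  (forall y, 0 <= y <= 1 -> Normc.normc (g x - g y) <= L * `|x - y|) ->
  Normc.normc (g x - \sum_(k < n.+1) (bernstein n k x)%:C * g (k%:R / n%:R)) <=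
  L * (eta + (n%:R * eta)^-1).
Proof.
move=> n0 eta0 L0 x01 gL.
have nR0 : 0 < n%:R :> R by rewrite ltr0n.
have -> : g x = \sum_(k < n.+1) (bernstein n k x)%:C * g x.
  by rewrite -mulr_suml -rmorph_sum sum_bernstein rmorph1 mul1r.
rewrite -sumrB; apply: le_trans (normc_sum _ _ _ _ _) _.
have -> : L * (eta + (n%:R * eta)^-1) =
  L * (\sum_(k < n.+1) bernstein n k x * eta + (n%:R * eta)^-1).
  by rewrite -mulr_suml sum_bernstein mul1r.
(* The factor 1 / n^2 rescales (k - n x)^2 into (x - k/n)^2, which brings the sum to the form of
   [bernstein_variance]. *)
apply: (@le_trans _ _ (\sum_(k < n.+1) L * (bernstein n k x * eta +
    (n%:R ^+ 2 * eta)^-1 * (bernstein n k x * (k%:R - n%:R * x) ^+ 2)))).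
  apply: ler_sum => k _.
  rewrite -mulrBr Normc.normcM normc_real ger0_norm ?bernstein_ge0 //.
  set B := bernstein n k x.
  have -> : L * (B * eta +
      (n%:R ^+ 2 * eta)^-1 * (B * (k%:R - n%:R * x) ^+ 2)) =
    B * (L * (eta + (x - k%:R / n%:R) ^+ 2 / eta)).
    by field; rewrite !gt_eqF.
  rewrite ler_wpM2l ?bernstein_ge0 //.
  have k01 : 0 <= (k%:R / n%:R : R) <= 1.
    by rewrite divr_ge0 //= ler_pdivrMr // mul1r ler_nat -ltnS.
  apply: le_trans (gL _ k01) _; rewrite ler_wpM2l //.
  (* It suffices that [d <= eta + d^2 / eta] for [d >= 0]. *)
  set d := x - _; rewrite -(real_normK (num_real d)).
  have [ed|de] := leP `|d| eta.
    by rewrite ler_wpDr ?divr_ge0 ?exprn_ge0 ?(ltW eta0).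
  by rewrite ler_wpDl ?(ltW eta0) // ler_pdivlMr // expr2 ler_wpM2l // (ltW de).
rewrite -mulr_sumr ler_wpM2l // big_split /= lerD2l -mulr_sumr.
rewrite bernstein_variance.
have -> : (n%:R ^+ 2 * eta)^-1 * (n%:R * (x * (1 - x))) =
  x * (1 - x) / (n%:R * eta) by field; rewrite !gt_eqF.
rewrite ler_pdivrMr ?mulr_gt0 // mulVf ?mulf_neq0 ?gt_eqF //.
by nra.
Qed.

(** * Lipschitz bounds for the complex exponential and the logarithm *)

Lemma cexpM (R : realType) (l : R[i]) (t : R) :
  cexp (l * t%:C) = (expR (complex.Re l * t) * cos (complex.Im l * t)) +i*
                    (expR (complex.Re l * t) * sin (complex.Im l * t)).
Proof.
case: l => a c; rewrite /cexp /= !mulr0 subr0 add0r.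
by rewrite /GRing.mul /= !mul0r subr0 addr0.
Qed.

Lemma cexp_real (R : realType) (a t : R) :
  cexp (a%:C * t%:C) = (expR (a * t))%:C.
Proof. by rewrite cexpM /= mul0r cos0 sin0 mulr1 mulr0. Qed.

Lemma lipschitz_derive (R : realType) (f df : R -> R) (v K : R) :
  (forall x : R, is_derive x 1 f (df x)) ->
  (forall x, 0 <= x <= v -> `|df x| <= K) ->
  forall x y, 0 <= x <= v -> 0 <= y <= v -> `|f x - f y| <= K * `|x - y|.
Proof.
move=> fd dfK x y; wlog xy : x y / x <= y => [H xv yv|/andP[x0 _] /andP[_ yv]].
  case/orP: (le_total x y) => [xy|yx]; first exact: H.
  by rewrite distrC [`|x - y|]distrC; apply: H.
have [|c] := @MVT_segment R f df x y xy.
  by apply: derivable_within_continuous => z _; case: (fd z).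
rewrite in_itv /= => /andP[xc cy] E.
rewrite distrC E normrM [`|x - y|]distrC ler_wpM2r // dfK //.
by rewrite (le_trans x0) // (le_trans cy).
Qed.

(** The mean value theorem fails for complex-valued functions, so it is applied to the real and
    imaginary parts separately; hence the constant [K + K]. *)
Lemma lipschitz_cexp (R : realType) (l : R[i]) (v : R) :
  exists2 K : R, 0 <= K &
  forall x y, 0 <= x <= v -> 0 <= y <= v ->
    Normc.normc (cexp (l * x%:C) - cexp (l * y%:C)) <= K * `|x - y|.
Proof.
case: l => a c.
pose K := (`|a| + `|c|) * expR (`|a| * v).
(* Both derivatives have this shape, with (p, q) = (cos, - sin) for the real part and (sin, cos) for
   the imaginary part. The [|a|] in the exponent of [K] covers either sign of [a]. *)
have bnd (p q t : R) : `|p| <= 1 -> `|q| <= 1 -> 0 <= t <= v ->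
    `|a * expR (a * t) * p + expR (a * t) * (c * q)| <= K.
  move=> p1 q1 /andP[t0 tv].
  have -> : a * expR (a * t) * p + expR (a * t) * (c * q) =
    (a * p + c * q) * expR (a * t) by ring.
  rewrite normrM (ger0_norm (expR_ge0 _)) ler_pM ?expR_ge0 //; last first.
    rewrite ler_expR (le_trans (ler_norm _)) // normrM (ger0_norm t0).
    by rewrite ler_wpM2l.
  by rewrite (le_trans (ler_normD _ _)) // !normrM lerD // ler_piMr.
have dlin (b x : R) : is_derive x 1 (fun t => b * t) b.
  by apply: is_derive_eq; rewrite /GRing.scale /= mulr1.
have dexp (x : R) : is_derive x 1 (fun t => expR (a * t)) (a * expR (a * x)).
  by rewrite mulrC; apply: is_derive1_comp.
exists (K + K) => [|x y xv yv].
  by rewrite addr_ge0 // mulr_ge0 ?addr_ge0 ?expR_ge0.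
rewrite !cexpM (le_trans (normc_le_ReIm _ _)) // mulrDl lerD //=.
  apply: (@lipschitz_derive _ (fun t => expR (a * t) * cos (c * t))
    (fun t => a * expR (a * t) * cos (c * t) +
              expR (a * t) * (c * - sin (c * t)))
    v) => // [t|t tv].
    have dcos : is_derive t 1 (fun t => cos (c * t)) (- sin (c * t) * c).
      exact: is_derive1_comp.
    by apply: is_derive_eq; rewrite /GRing.scale /=; ring.
  by apply: bnd; rewrite ?normrN ?cos_max ?sin_max.
apply: (@lipschitz_derive _ (fun t => expR (a * t) * sin (c * t))
    (fun t => a * expR (a * t) * sin (c * t) +
              expR (a * t) * (c * cos (c * t)))
    v) => // [t|t tv].
  have dsin : is_derive t 1 (fun t => sin (c * t)) (cos (c * t) * c).
    exact: is_derive1_comp.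
  by apply: is_derive_eq; rewrite /GRing.scale /=; ring.
by apply: bnd; rewrite ?cos_max ?sin_max.
Qed.

(** For x <= y, ln y - ln x = ln (1 + (y - x) / x) <= (y - x) / x, and x >= b. *)
Lemma lipschitz_ln (R : realType) (b x y : R) :
  0 < b -> b <= x -> b <= y -> `|ln x - ln y| <= `|x - y| / b.
Proof.
move=> b0; wlog xy : x y / x <= y => [H bx yb|bx yb].
  case/orP: (le_total x y) => [xy|yx]; first exact: H.
  by rewrite distrC [`|x - y|]distrC; apply: H.
have x0 : 0 < x by exact: lt_le_trans bx.
have y0 : 0 < y by exact: lt_le_trans yb.
rewrite distrC ger0_norm ?subr_ge0 ?ler_ln ?posrE // -ln_div ?posrE //.
have -> : y / x = 1 + (y - x) / x by field; rewrite gt_eqF.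
have h0 : 0 <= (y - x) / x by rewrite divr_ge0 ?subr_ge0 // ltW.
rewrite (le_trans (le_ln1Dx _)) ?(lt_le_trans _ h0) ?ltrN10 //.
rewrite distrC ger0_norm ?subr_ge0 // ler_wpM2l ?subr_ge0 //.
by rewrite lef_pV2 // posrE.
Qed.

(** * The change of variable between [0, vartheta] and [0, 1] *)

Section Approximants.
Variables (R : realType) (vartheta alpha : R) (lambda : R[i]).
Hypotheses (hvartheta : 0 < vartheta) (halpha : 0 < alpha).

Let b := expR (- alpha * vartheta).

Let b_gt0 : 0 < b. Proof. exact: expR_gt0. Qed.

Let b_lt1 : b < 1.
Proof. by rewrite /b mulNr expR_lt1 oppr_lt0 mulr_gt0. Qed.

Let b_neq1 : 1 - b != 0. Proof. by rewrite gt_eqF // subr_gt0. Qed.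

Let affine_bounds (mu : R) : 0 <= mu <= 1 -> b <= (1 - b) * mu + b <= 1.
Proof.
move=> /andP[mu0 mu1]; have s0 : 0 <= 1 - b by rewrite subr_ge0 ltW.
by rewrite lerDr mulr_ge0 //= -lerBrDr ler_piMr.
Qed.

(** With [affine_bounds], this keeps the argument of [theta] in [Phi] inside [0, vartheta], where
    [theta] is the smooth exponential. *)
Let time_bounds (w : R) :
  b <= w <= 1 -> 0 <= - alpha^-1 * ln w <= vartheta.
Proof.
move=> /andP[bw w1]; have w0 : 0 < w by exact: lt_le_trans bw.
have lnw1 : ln w <= 0 by rewrite ln_le0.
have lnwb : - alpha * vartheta <= ln w.
  by rewrite -(expRK (- alpha * vartheta)) ler_ln ?posrE.
rewrite mulNr -mulrN mulr_ge0 ?invr_ge0 ?oppr_ge0 ?(ltW halpha) //=.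
by rewrite mulrC ler_pdivrMr // mulrC lerNl -mulNr.
Qed.

Lemma lipschitz_Phi : exists2 L : R, 0 <= L &
  forall x y, 0 <= x <= 1 -> 0 <= y <= 1 ->
  Normc.normc (Phi vartheta alpha lambda x - Phi vartheta alpha lambda y) <=
  L * `|x - y|.
Proof.
have [K K0 lipK] := lipschitz_cexp _ lambda vartheta.
have lip_ge0 : 0 <= (1 - b) / (alpha * b).
  by rewrite divr_ge0 ?subr_ge0 ?mulr_ge0 ?ltW.
(* The product of the Lipschitz constants along the composition: 1 - b for the affine map, 1 / b for
   the logarithm on [b, 1], 1 / alpha for the scaling and [K] for the exponential. *)
exists (K * ((1 - b) / (alpha * b))) => [|x y x01 y01]; first exact: mulr_ge0.
have xb := affine_bounds _ x01; have yb := affine_bounds _ y01.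
have xt := time_bounds _ xb; have yt := time_bounds _ yb.
rewrite /Phi /theta -/b xt yt; apply: le_trans (lipK _ _ xt yt) _.
rewrite -mulrA ler_wpM2l // -mulrBr normrM normrN normfV (gtr0_norm halpha).
have [/andP[bx _] /andP[by_ _]] := (xb, yb).
rewrite ler_pdivrMl //; apply: le_trans (lipschitz_ln _ _ _ _ b_gt0 bx by_) _.
have -> : (1 - b) * x + b - ((1 - b) * y + b) = (1 - b) * (x - y) by ring.
rewrite normrM ger0_norm ?subr_ge0 ?(ltW b_lt1) //.
suff -> : (1 - b) * `|x - y| / b =
  alpha * ((1 - b) / (alpha * b) * `|x - y|) by [].
by field; rewrite !gt_eqF.
Qed.

Let node (t : R) := (expR (- alpha * t) - b) / (1 - b).

Let node_bounds (t : R) : 0 <= t <= vartheta -> 0 <= node t <= 1.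
Proof.
move=> /andP[t0 tv]; have s0 : 0 < 1 - b by rewrite subr_gt0.
rewrite /node divr_ge0 ?(ltW s0) ?subr_ge0 /b ?ler_expR ?ler_wnM2l //=;
  last by rewrite oppr_le0 ltW.
rewrite ler_pdivrMr // mul1r lerD2r -expR0 ler_expR mulNr oppr_le0.
by rewrite mulr_ge0 // ltW.
Qed.

Lemma Phi_node (t : R) :
  Phi vartheta alpha lambda (node t) = theta vartheta lambda t.
Proof.
rewrite /Phi -/b /node (mulrC (1 - b)) divfK // subrK expRK.
by rewrite mulNr mulNr mulrN opprK mulKf // gt_eqF.
Qed.

(** The normalising (1 - b)^n splits as (1 - b)^k (1 - b)^(n - k), which turns the two powers into
    those of [node t] and [1 - node t]. *)
Lemma theta_seq_bernstein (n : nat) (t : R) : 0 <= t <= vartheta ->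
  theta_seq vartheta alpha lambda n t =
  \sum_(k < n.+1) (bernstein n k (node t))%:C *
                  Phi vartheta alpha lambda (k%:R / n%:R).
Proof.
move=> tv; rewrite /theta_seq tv -/b big_mkord mulr_sumr.
apply: eq_bigr => k _; have kn : (k <= n)%N by rewrite -ltnS.
have <- : ((1 - b) ^+ n)^-1 * ('C(n, k)%:R * (expR (- alpha * t) - b) ^+ k *
    (1 - expR (- alpha * t)) ^+ (n - k)) = bernstein n k (node t).
  have -> : 1 - expR (- alpha * t) = (1 - b) * (1 - node t).
    by rewrite /node; field.
  have -> : expR (- alpha * t) - b = (1 - b) * node t.
    by rewrite /node (mulrC (1 - b)) divfK.
  move: (node t) => x; rewrite /bernstein !exprMn.
  rewrite -[in X in X^-1](subnKC kn) exprD.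
  move: ((1 - x) ^+ _) (x ^+ k) => u v.
  by field; rewrite !expf_neq0.
by rewrite !rmorphM rmorph_nat /=; ring.
Qed.

(** Serves twice: the coefficients of [P] give the exponential sum required by [Ks], and continuity
    of polynomials gives integrability. *)
Lemma theta_seq_poly (n : nat) : exists P : {poly R[i]},
  forall t, 0 <= t <= vartheta ->
  theta_seq vartheta alpha lambda n t = P.[(expR (- alpha * t))%:C].
Proof.
exists (((((1 - b) ^+ n)^-1)%:C)%:P * \sum_(0 <= k < n.+1)
  ('C(n, k)%:R * Phi vartheta alpha lambda (k%:R / n%:R))%:P *
  ('X - (b%:C)%:P) ^+ k * (1 - 'X) ^+ (n - k)) => t tv.
rewrite /theta_seq tv hornerM hornerC horner_sum; congr (_ * _).
apply: eq_bigr => k _; rewrite !hornerE.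
by rewrite !rmorphXn !rmorphB rmorph1.
Qed.

Lemma theta_approx (eps : R) : 0 < eps ->
  exists2 n : nat, (0 < n)%N & forall k t, (n <= k)%N -> 0 <= t <= vartheta ->
    Normc.normc (theta vartheta lambda t - theta_seq vartheta alpha lambda k t)
    <= eps.
Proof.
move=> eps0; have [L L0 lipL] := lipschitz_Phi.
have L1 : 0 < L + 1 by rewrite ltr_wpDl.
(* [L + 1] replaces [L], which may be 0, in the denominator. *)
pose eta := eps / (2 * (L + 1)).
have eta0 : 0 < eta by rewrite divr_gt0 ?mulr_gt0.
have etaE : (L + 1) * (eta + eta) = eps by rewrite /eta; field; rewrite gt_eqF.
move: eta eta0 etaE => {}eta eta0 etaE.
(* From k >= 1 / eta^2 follows 1 / (k eta) <= eta, so both error terms are at most [eta]. *)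
exists (Num.truncn (eta ^- 2)).+1 => // k t nk tv.
have k0 : (0 < k)%N by exact: leq_trans nk.
have kR0 : 0 < k%:R :> R by rewrite ltr0n.
have etak : eta ^- 2 <= k%:R.
  by rewrite (le_trans (ltW (truncnS_gt _))) // ler_nat.
rewrite -Phi_node theta_seq_bernstein //.
have nt := node_bounds _ tv.
apply: le_trans (bernstein_approx _ _ L eta _ _ k0 eta0 L0 nt _) _.
  by move=> y y01; exact: lipL.
have keta : (k%:R * eta)^-1 <= eta.
  rewrite -[leRHS]invrK lef_pV2 ?posrE ?mulr_gt0 ?invr_gt0 //.
  have -> : eta^-1 = eta ^- 2 * eta by field; rewrite gt_eqF.
  by rewrite ler_wpM2r // ltW.
apply: (@le_trans _ _ ((L + 1) * (eta + eta))).
  rewrite ler_pM ?lerD2l ?lerDl // addr_ge0 ?(ltW eta0) //.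
  by rewrite invr_ge0 mulr_ge0 // ltW.
by rewrite etaE.
Qed.

Lemma theta_seq_Ks (n : nat) : exists c : R[i],
  Ks vartheta (fun t => theta_seq vartheta alpha lambda n t -
                        c * theta vartheta 0 t).
Proof.
have [P thetaP] := theta_seq_poly n; exists P`_0; split => [t tv|].
  by rewrite /theta_seq /theta (negbTE tv) mulr0 subr0.
(* The constant coefficient of [P] goes with [theta vartheta 0]. The coefficient of index i + 1 goes
   with the exponent - (i + 1) alpha < 0, and only the power t^0 occurs. *)
exists (size P).-1, 1%N, (fun i _ => P`_i.+1),
  (fun i => (- (i.+1%:R * alpha))%:C).
split => [i|t tv] /=; first by rewrite oppr_lt0 mulr_gt0.
(* Widening the expansion to [(size P).-1.+1] terms isolates the constant one even when [P] is 0. *)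
rewrite thetaP // (horner_coef_wide _ (leqSpred _)) big_ord_recl /= mulr1.
rewrite /theta tv -(rmorph0 (real_complex R)) cexp_real mul0r expR0 mulr1.
rewrite addrAC subrr add0r; apply: eq_bigr => i _.
rewrite /bump /= add1n big_ord1 mulr1 cexp_real -rmorphXn -expRM_natl.
congr (_ * (expR _)%:C).
by rewrite mulrA mulrN.
Qed.

End Approximants.

(** * Continuity, integrability and L^1 norm of cut-off functions *)

Definition continuous_ReIm {R : realType} (f : R -> R[i]) : Prop :=
  continuous (fun t => complex.Re (f t)) /\
  continuous (fun t => complex.Im (f t)).

(** The common shape of the limit and of the approximants: [f] will be continuous on the whole line,
    so the jumps at 0 and [v] come from the cut-off alone. *)
Definition cutoff {R : realType} (v : R) (f : R -> R[i]) (t : R) : R[i] :=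
  if 0 <= t <= v then f t else 0.

Section ContinuousReIm.
Variable R : realType.
Implicit Types f g : R -> R[i].

Lemma continuous_ReIm_cst (c : R[i]) : continuous_ReIm (fun _ : R => c).
Proof. by split=> t; exact: cvg_cst. Qed.

Lemma continuous_ReImD f g :
  continuous_ReIm f -> continuous_ReIm g ->
  continuous_ReIm (fun t => f t + g t).
Proof.
move=> [f1 f2] [g1 g2]; split=> t.
  rewrite (_ : (fun _ => _) = (fun t => complex.Re (f t) + complex.Re (g t))).
    by apply: cvgD; [exact: f1|exact: g1].
  by apply/funext => u; case: (f u) (g u) => ? ? [? ?].
rewrite (_ : (fun _ => _) = (fun t => complex.Im (f t) + complex.Im (g t))).
  by apply: cvgD; [exact: f2|exact: g2].
by apply/funext => u; case: (f u) (g u) => ? ? [? ?].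
Qed.

Lemma continuous_ReImM f g :
  continuous_ReIm f -> continuous_ReIm g ->
  continuous_ReIm (fun t => f t * g t).
Proof.
move=> [f1 f2] [g1 g2]; split=> t.
  rewrite (_ : (fun _ => _) = (fun t => complex.Re (f t) * complex.Re (g t) -
      complex.Im (f t) * complex.Im (g t))).
    by apply: cvgB; apply: cvgM; do ?[exact: f1|exact: g1|exact: f2|exact: g2].
  by apply/funext => u; case: (f u) (g u) => ? ? [? ?].
rewrite (_ : (fun _ => _) = (fun t => complex.Re (f t) * complex.Im (g t) +
    complex.Im (f t) * complex.Re (g t))).
  by apply: cvgD; apply: cvgM; do ?[exact: f1|exact: g1|exact: f2|exact: g2].
by apply/funext => u; case: (f u) (g u) => ? ? [? ?].
Qed.

Lemma continuous_ReIm_horner (P : {poly R[i]}) f :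
  continuous_ReIm f -> continuous_ReIm (fun t => P.[f t]).
Proof.
move=> cf; elim/poly_ind: P => [|P c IH].
  under [X in continuous_ReIm X]eq_fun do rewrite horner0.
  exact: continuous_ReIm_cst.
under [X in continuous_ReIm X]eq_fun do rewrite hornerMXaddC.
by apply: continuous_ReImD (continuous_ReIm_cst c); exact: continuous_ReImM.
Qed.

Lemma continuous_ReIm_cexp (l : R[i]) :
  continuous_ReIm (fun t : R => cexp (l * t%:C)).
Proof.
have lin (a : R) : continuous (fun t : R => a * t) by exact: mulrl_continuous.
have cexpR (a : R) : continuous (fun t : R => expR (a * t)).
  by move=> t; apply: continuous_comp; [exact: lin|exact: continuous_expR].
under [X in continuous_ReIm X]eq_fun do rewrite cexpM.
split=> t /=; apply: cvgM; try exact: cexpR.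
  by apply: continuous_comp; [exact: lin|exact: continuous_cos].
by apply: continuous_comp; [exact: lin|exact: continuous_sin].
Qed.

Lemma continuous_normc f :
  continuous_ReIm f -> continuous (fun t => Normc.normc (f t)).
Proof.
move=> [f1 f2] t.
rewrite (_ : (fun _ => _) = Num.sqrt \o
   (fun t => complex.Re (f t) ^+ 2 + complex.Im (f t) ^+ 2)); last first.
  by apply/funext => u /=; case: (f u).
apply: continuous_comp; last exact: sqrt_continuous.
by apply: cvgD; apply: cvgM; (exact: f1 || exact: f2).
Qed.

(** Instantiated with the real part, the imaginary part and the modulus, to move integrals from the
    half-line to the compact [0, v]. *)
Lemma cutoff_patch (h : R[i] -> R) (v : R) f : h 0 = 0 ->
  (fun t => (h (cutoff v f t))%:E) =
  ((fun t => (h (f t))%:E) \_ `[0, v]%classic)%classic.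
Proof.
move=> h0; apply/funext => t; rewrite /cutoff patchE.
by rewrite mem_setE in_itv /=; case: ifP; rewrite ?h0.
Qed.

Let itv_sub (v : R) :
  (`[0, +oo[ `&` `[0, v] = (`[0, v] : set R))%classic.
Proof.
apply/setIidPr => t /=; rewrite !in_itv /= => /andP[t0 _].
by rewrite t0.
Qed.

Lemma L1_cutoff (v : R) f : continuous_ReIm f -> L1 (cutoff v f).
Proof.
have key (h : R[i] -> R) : h 0 = 0 -> continuous (fun t => h (f t)) ->
  lebesgue_measure.-integrable `[0, +oo[%classic
    (fun t => (h (cutoff v f t))%:E).
  move=> h0 ch; rewrite cutoff_patch //; apply/integrable_restrict => //.
  rewrite itv_sub; apply: continuous_compact_integrable.
    exact: segment_compact.
  exact: continuous_subspaceT.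
by move=> [f1 f2]; split; exact: key.
Qed.

Lemma normA_cutoff (v e : R) f : 0 <= v -> continuous_ReIm f ->
  (forall t, 0 <= t <= v -> Normc.normc (f t) <= e) ->
  (normA (cutoff v f) <= (e * v)%:E)%E.
Proof.
move=> v0 cf fe; rewrite /normA cutoff_patch ?Normc.normc0 //.
rewrite -integral_mkcondr itv_sub.
have -> : ((e * v)%:E = \int[lebesgue_measure]_(t in `[0%R, v]) cst e%:E t)%E.
  rewrite integral_cst //= lebesgue_measure_itv /= lte_fin.
  (* The length of an interval is given by cases; the second one is v = 0. *)
  case: ltP => [_|v_le0]; first by rewrite -EFinB subr0 EFinM.
  have /eqP -> : v == 0 by rewrite eq_le v0 v_le0.
  by rewrite mulr0 mule0.
apply: ge0_le_integral => //.
- by move=> t _; rewrite lee_fin; case: (f t) => a b /=; exact: sqrtr_ge0.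
- apply/measurable_realfun.measurable_EFinP; apply: measurable_funTS.
  exact: measurable_realfun.continuous_measurable_fun (continuous_normc _ cf).
Qed.

End ContinuousReIm.

Theorem lemma5 (R : realType) (vartheta alpha : R) (lambda : R[i])
    (hvartheta : 0 < vartheta) (halpha : 0 < alpha) :
  (forall n : nat, (0 < n)%N ->
     exists c : R[i],
       Ks vartheta (fun t => theta_seq vartheta alpha lambda n t
                             - c * theta vartheta 0 t)) /\
  uniformly_converges (theta_seq vartheta alpha lambda)
                      (theta vartheta lambda).
Proof.
split=> [n _|]; first exact: theta_seq_Ks.
have ctheta := continuous_ReIm_cexp _ lambda.
have thetaE : theta vartheta lambda =
  cutoff vartheta (fun t => cexp (lambda * t%:C)) by [].
have cseq n : exists2 f : R -> R[i], continuous_ReIm f &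
    theta_seq vartheta alpha lambda n = cutoff vartheta f.
  have [P PE] := theta_seq_poly _ vartheta alpha lambda n.
  (* The real exponential is written as [cexp] to reuse the continuity of the latter. *)
  exists (fun t => P.[cexp ((- alpha)%:C * t%:C)]).
    exact: continuous_ReIm_horner (continuous_ReIm_cexp _ _).
  apply/funext => t; rewrite /cutoff; case: ifP => tv.
    by rewrite PE // cexp_real.
  by rewrite /theta_seq tv.
split=> [|n _|eps eps0].
- by rewrite thetaE; exact: L1_cutoff.
- by have [f cf ->] := cseq n; exact: L1_cutoff.
(* Integrating over [0, vartheta] multiplies the uniform bound by [vartheta]. *)
have e0 : 0 < eps / vartheta by rewrite divr_gt0.
have [n n0 close] :=
  theta_approx _ _ _ lambda hvartheta halpha _ e0.
exists n => // k nk; have [f cf fE] := cseq k.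
have -> : (fun t => theta vartheta lambda t -
    theta_seq vartheta alpha lambda k t) =
  cutoff vartheta (fun t => cexp (lambda * t%:C) + -1 * f t).
  apply/funext => t; rewrite thetaE fE /cutoff mulN1r.
  by case: ifP => // _; rewrite subrr.
rewrite -[X in X%:E](divfK (lt0r_neq0 hvartheta)); apply: normA_cutoff.
- exact: ltW.
- exact: continuous_ReImD (continuous_ReImM _ _ _ (continuous_ReIm_cst _ _) cf).
- move=> t tv; have := close k t nk tv.
  by rewrite thetaE fE /cutoff tv mulN1r.
Qed.
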